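(* Let $A=(a_{ij})$ be an $N\times N$ matrix with real entries and let $\theta_0=(\theta_1,\dots,\theta_N)\in\mathbb{R}^N$. Suppose that $x_0=e^{\mathbf{i}\theta_0}=(e^{\mathbf{i}\theta_1},\dots,e^{\mathbf{i}\theta_N})^T$ is an eigenvector of $A$ associated with a real eigenvalue $\lambda$. Then $\theta_0$ is an equilibrium point of the original Kuramoto model $$\frac{d\theta_i}{dt}=\epsilon\sum_{j=1}^N a_{ij}\sin(\theta_j-\theta_i),\qquad 1\le i\le N.$$
   Context: Here $\mathbf{i}=\sqrt{-1}$ and $\epsilon\in\mathbb{R}$ is the coupling strength. A point $\theta_0=(\theta_1,\dots,\theta_N)\in\mathbb{R}^N$ is an equilibrium point of the original Kuramoto model (with all natural frequencies equal to $0$) if $\sum_{j=1}^N a_{ij}\sin(\theta_j-\theta_i)=0$ for all $1\le i\le N$. *)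

(* Defs.v *)
From mathcomp Require Import all_boot all_order all_algebra.
From mathcomp Require Import complex.
From mathcomp Require Import reals sequences exp trigo.

Set Implicit Arguments.
Unset Strict Implicit.
Unset Printing Implicit Defensive.

Import GRing.Theory.
Local Open Scope ring_scope.
Local Open Scope complex_scope.

Definition cexp (R : realType) (z : R[i]) : R[i] :=
  (expR (complex.Re z))%:C *
    (cos (complex.Im z) +i* sin (complex.Im z)).

Definition phase_vector (R : realType) (N : nat) (theta : 'cV[R]_N) :
    'cV[R[i]]_N :=
  \col_j cexp ('i%C * (theta j 0)%:C).

(* MathComp's [eigenspace] is about row vectors (v *m A = a *: v); the
   eigenvectors here are columns. *)
Definition is_eigenvector (F : fieldType) (N : nat) (A : 'M[F]_N)
    (a : F) (x : 'cV[F]_N) : Prop :=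
  x != 0 /\ A *m x = a *: x.

(* Equilibrium of  d theta_i / dt = eps * \sum_j a_ij sin (theta_j - theta_i).
   The coupling strength eps does not enter the condition, so that the notion
   does not become vacuous for eps = 0. *)
Definition kuramoto_equilibrium (R : realType) (N : nat) (A : 'M[R]_N)
    (theta : 'cV[R]_N) : Prop :=
  forall i : 'I_N, \sum_(j < N) A i j * sin (theta j 0 - theta i 0) = 0.

(* Main.v *)
(* Since A and lambda are real, the real and imaginary parts of row i of
   A x0 = lambda x0 say that \sum_j a_ij cos theta_j = lambda cos theta_i and
   \sum_j a_ij sin theta_j = lambda sin theta_i; expanding
   sin (theta_j - theta_i), the two contributions cancel. *)
Require Import Defs.
From mathcomp Require Import all_boot all_order all_algebra.
From mathcomp Require Import complex.
From mathcomp Require Import reals.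
From mathcomp Require Import exp trigo.

Import GRing.Theory.
Local Open Scope ring_scope.
Local Open Scope complex_scope.

(** The exponent has real part 0, so the modulus factor is [expR 0 = 1]. *)
Lemma cexp_imaginary (R : realType) (t : R) :
  cexp ('i%C * t%:C) = cos t +i* sin t.
Proof.
by rewrite /cexp /= !(mul0r, mul1r) subrr add0r expR0 mul1r.
Qed.

Lemma eigenvector_phase_row {R : realType} {N : nat} {A : 'M[R]_N}
    {theta : 'cV[R]_N} {lambda : R} (i : 'I_N) :
  map_mx (real_complex R) A *m phase_vector theta =
    lambda%:C *: phase_vector theta ->
  \sum_(j < N) A i j * cos (theta j 0) = lambda * cos (theta i 0) /\
  \sum_(j < N) A i j * sin (theta j 0) = lambda * sin (theta i 0).
Proof.
move=> /matrixP /(_ i 0); rewrite !mxE cexp_imaginary.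
under eq_bigr => j _ do rewrite !mxE cexp_imaginary.
move=> row_i; split.
(* [Re] is additive, hence passes through the sum; the zero imaginary parts of the embedded reals
   [A i j] and [lambda] kill the cross terms. *)
- have := congr1 (@complex.Re R) row_i; rewrite raddf_sum /= mul0r subr0 => <-.
  by apply: eq_bigr => j _; rewrite mul0r subr0.
- have := congr1 (@complex.Im R) row_i; rewrite raddf_sum /= mul0r addr0 => <-.
  by apply: eq_bigr => j _; rewrite mul0r addr0.
Qed.

Theorem proposition2 (R : realType) (N : nat) (A : 'M[R]_N)
    (theta0 : 'cV[R]_N) (lambda : R)
    (Heig : is_eigenvector (map_mx (real_complex R) A) lambda%:C
              (phase_vector theta0)) :
  kuramoto_equilibrium A theta0.
Proof.
move=> i; have [sum_cos sum_sin] := eigenvector_phase_row i (proj2 Heig).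
under eq_bigr => j _ do rewrite sinB mulrBr !mulrA.
(* With the factors in [theta i 0] pulled out, both sums equal [lambda * cos (theta i 0) * sin
   (theta i 0)] up to order. *)
by rewrite sumrB -!mulr_suml sum_cos sum_sin mulrAC subrr.
Qed.
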